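(* The class of Markov semigroups is closed under forming finite Rees index extensions and subsemigroups. That is, if $S$ is a semigroup and $T$ is a subsemigroup of $S$ of finite Rees index, then: if $T$ is Markov, $S$ is Markov; and if $S$ is Markov, $T$ is Markov.
   Context: A subsemigroup $T$ of a semigroup $S$ has finite Rees index in $S$ if $S - T$ is finite. A finite alphabet $A$ represents a generating set for a semigroup $S$ if there is a map $\phi : A \to S$ extending to a surjective homomorphism $A^+ \to S$; $\overline{w} = w\phi$ is the element represented by $w \in A^+$. A language $L$ over $A$ is $+$-prefix-closed if for all $u \in A^+$, $v \in A^+$, $uv \in L$ implies $u \in L$. A Markov language for $S$ over $A$ is a regular $+$-prefix-closed language $L \subseteq A^+$ (not containing the empty word) such that every element of $S$ is represented by exactly one word in $L$. $S$ is Markov if it admits a Markov language over some finite alphabet representing a generating set for $S$. *)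

(* Defs.v *)
From mathcomp Require Import all_boot.
From mathcomp Require Import boolp classical_sets.

Set Implicit Arguments.
Unset Strict Implicit.
Unset Printing Implicit Defensive.

Local Open Scope group_scope.

Record dfa (A : finType) := Dfa {
  dfa_state : finType;
  dfa_init : dfa_state;
  dfa_step : dfa_state -> A -> dfa_state;
  dfa_final : {pred dfa_state}
}.

Definition dfa_accepts (A : finType) (M : dfa A) (w : seq A) : bool :=
  foldl (@dfa_step A M) (dfa_init M) w \in @dfa_final A M.

Definition regular (A : finType) (L : set (seq A)) : Prop :=
  exists M : dfa A, forall w, L w <-> dfa_accepts M w.

Definition plus_prefix_closed (A : Type) (L : set (seq A)) : Prop :=
  forall u v : seq A, u <> [::] -> v <> [::] -> L (u ++ v) -> L u.

(* The graph of the homomorphism A^+ -> S extending phi. Elements of A^+ are the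
   nonempty sequences; the empty word represents nothing, as S need not have
   an identity. *)
Definition represents (S : semigroupType) (A : Type) (phi : A -> S)
    (w : seq A) (s : S) : Prop :=
  if w is a :: u then foldl (fun x b => x * phi b) (phi a) u = s else False.

Lemma represents_cat (S : semigroupType) (A : Type) (phi : A -> S) u v s t :
  represents phi u s -> represents phi v t -> represents phi (u ++ v) (s * t).
Proof.
case: u v => [|a u] [|b v] //= <- <-; rewrite foldl_cat /=.
elim/last_ind: v => [|v c IH] //=; rewrite -!cats1 !foldl_cat /= IH.
by rewrite mulgA.
Qed.

Definition generates (S : semigroupType) (A : Type) (phi : A -> S) : Prop :=
  forall s : S, exists w, represents phi w s.

Definition Markov_language (S : semigroupType) (A : finType) (phi : A -> S)
    (L : set (seq A)) : Prop :=
  [/\ ~ L [::],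
      regular L,
      plus_prefix_closed L &
      forall s : S, exists! w, L w /\ represents phi w s].

Definition Markov (S : semigroupType) : Prop :=
  exists (A : finType) (phi : A -> S),
    generates phi /\ exists L : set (seq A), Markov_language phi L.

(* Main.v *)
(**
  Let F = S - T. To extend a Markov language for T to S, add one new letter per
  element of F.

  Conversely, let L be a Markov language for S, recognised by an automaton M,
  and let D be its words representing elements of T. Define the parent of w in D
  as its longest proper prefix v in D such that w = v s with s representing an
  element of T (the empty word if there is none), and label the edge from v to w
  by s. Reading labels along paths from the root gives a cross-section for T
  that is prefix-closed by construction. The labels have bounded length: among enough
  consecutive suffixes all representing elements of F, two have the same value
  and are preceded by prefixes leading to the same state of M; swapping them
  gives two words of L for the same element. The set of edges leaving v depends
  only on the state reached by v in an automaton for D, whence regularity.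
*)

Require Import Defs.
From mathcomp Require Import all_boot.
From mathcomp Require Import boolp classical_sets cardinality.
From mathcomp Require Import zify.

Local Open Scope classical_set_scope.

Set Implicit Arguments.
Unset Strict Implicit.
Unset Printing Implicit Defensive.

(** A Myhill-Nerode argument: the automaton reads a letter by appending it to the representative
    [g x] of its state [x]. The state reached on [w] may differ from [c w], but its representative
    has the same residual as [w]. *)
Lemma regular_of_residuals (A X : finType) (c : seq A -> X) (L : set (seq A)) :
  (forall u v, c u = c v -> forall z, L (u ++ z) <-> L (v ++ z)) -> regular L.
Proof.
move=> cL.
have /choice[g gP] (x : X) : exists u, (exists v, c v = x) -> c u = x.
  by have [[v cv]|nx] := pselect (exists v, c v = x);
    [exists v | exists [::]].
have cg u : c (g (c u)) = c u by apply: gP; exists u.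
exists (@Dfa A X (c [::]) (fun x a => c (rcons (g x) a))
  (fun x => `[< L (g x) >])) => w.
rewrite /dfa_accepts /=; set x := foldl _ _ w.
suff gx z : L (g x ++ z) <-> L (w ++ z).
  have := gx [::]; rewrite !cats0 => <-.
  by split=> [?|]; [apply/asboolP | move/asboolP].
rewrite /x {x}; elim/last_ind: w z => [|w a IH] z /=;
  first exact: (cL _ [::] (cg _)).
by rewrite foldl_rcons /= (cL _ _ (cg _)) !cat_rcons.
Qed.

(** * Words and the elements they represent *)

Section Represents.
Variables (S : semigroupType) (A : Type) (phi : A -> S).

Lemma represents_functional u s t :
  represents phi u s -> represents phi u t -> s = t.
Proof. by case: u => //= a u -> ->. Qed.

Lemma represents_total u : u <> [::] -> exists s, represents phi u s.
Proof. by case: u => // a u _; eexists. Qed.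

Definition represents_in (P : {pred S}) (w : seq A) : Prop :=
  exists2 s, s \in P & represents phi w s.

Lemma represents_in_neq0 P w : represents_in P w -> w <> [::].
Proof. by case: w => // - []. Qed.

End Represents.

(** Used with [h] the inclusion of T in S: for T, letters stand for words over the alphabet of S;
    for S, they become one-letter words. *)
Lemma represents_flatten (S T : semigroupType) (A B : Type) (phi : A -> S)
    (psi : B -> T) (h : T -> S) (f : B -> seq A) :
    {morph h : x y / (x * y)%g} ->
    (forall b, represents phi (f b) (h (psi b))) ->
  forall e t, represents psi e t -> represents phi (flatten (map f e)) (h t).
Proof.
move=> hM hf; elim/last_ind => [//|[|a e] b IH t /= <-]; first by rewrite cats0.
rewrite foldl_rcons hM map_rcons flatten_rcons catA.
by apply: represents_cat => //; apply: IH.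
Qed.

Lemma Markov_language_generates (S : semigroupType) (A : finType)
    (phi : A -> S) L : Markov_language phi L -> generates phi.
Proof. by case=> _ _ _ LS s; have [w [[_ ws] _]] := LS s; exists w. Qed.

Lemma Markov_language_inj (S : semigroupType) (A : finType)
    (phi : A -> S) L u v s : Markov_language phi L ->
  L u -> L v -> represents phi u s -> represents phi v s -> u = v.
Proof.
case=> _ _ _ LS Lu Lv us vs; have [w [_ wu]] := LS s.
by rewrite -(wu u) ?(wu v).
Qed.

(** * The tree of parents and its paths *)

Section Factorisation.
Variables (A : eqType) (D U : set (seq A)).
Hypothesis U0 : ~ U [::].

(* [v] is the parent of [v ++ s]. *)
Definition edge (v s : seq A) : Prop :=
  [/\ U s, D (v ++ s) &
      forall s1 s2, s = s1 ++ s2 -> s1 <> [::] -> D (v ++ s1) -> ~ U s2].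

(** Paths down the tree from [v], given by their labels. Later [D] is the set of words of [L] with
    value in T, and [U] that of all words with value in T. *)
Fixpoint chain (v : seq A) (e : seq (seq A)) : Prop :=
  if e is s :: e' then edge v s /\ chain (v ++ s) e' else True.

Lemma chain_cat v e1 e2 :
  chain v (e1 ++ e2) <-> chain v e1 /\ chain (v ++ flatten e1) e2.
Proof.
elim: e1 v => [|s e1 IH] v /=; first by rewrite cats0; tauto.
by rewrite IH catA; tauto.
Qed.

Lemma chain_rcons v e s :
  chain v (rcons e s) <-> chain v e /\ edge (v ++ flatten e) s.
Proof. by rewrite -cats1 chain_cat /=; tauto. Qed.

Lemma chain_flatten e : chain [::] e -> e <> [::] -> D (flatten e).
Proof.
by case/lastP: e => // e s /chain_rcons[_ [_ + _]] _; rewrite flatten_rcons.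
Qed.

(** Were the prefixes distinct, [v'] would properly extend [v], lie in [D] and leave the suffix [s']
    in [U], against the maximality of the parent [v]. *)
Lemma edge_inj v s v' s' :
    edge v s -> edge v' s' -> (v' <> [::] -> D v') -> size s' <= size s ->
  v ++ s = v' ++ s' -> v = v' /\ s = s'.
Proof.
move=> [_ _ vs_min] [Us' _ _] Dv' le_s eq_vs.
have le_v : size v <= size v'.
  by have := congr1 size eq_vs; rewrite !size_cat; lia.
move: eq_vs; rewrite -{1}[v'](cat_take_drop (size v)) -catA => /eqP.
rewrite eqseq_cat ?size_takel // => /andP[/eqP def_v /eqP def_s].
have def_v' : v' = v ++ drop (size v) v'
  by rewrite -{1}(cat_take_drop (size v) v') -def_v.
have [drop0|/eqP drop_neq0] := eqVneq (drop (size v) v') [::].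
  by rewrite def_v' def_s drop0 cats0.
have [] := vs_min _ _ def_s drop_neq0 _ Us'.
by rewrite -def_v'; apply: Dv' => v'0; rewrite v'0 in drop_neq0.
Qed.

(** A word determines its parent, so labels can be peeled off from the end. *)
Lemma chain_inj e e' :
  chain [::] e -> chain [::] e' -> flatten e = flatten e' -> e = e'.
Proof.
have nil e1 s : chain [::] (rcons e1 s) -> flatten (rcons e1 s) <> [::].
  case/chain_rcons => _ []; rewrite flatten_rcons.
  by case: (flatten _) s => [|? ?] [].
have Dflat e1 : chain [::] e1 -> flatten e1 <> [::] -> D (flatten e1).
  by move=> ch ne; apply: chain_flatten => // e10; rewrite e10 in ne.
elim/last_ind: e e' => [|e s IH] e'; case/lastP: e' => [|e' s'] //.
- by move=> _ /nil + /esym.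
- by move=> /nil.
move=> /chain_rcons[ch_e es] /chain_rcons[ch_e' es']; rewrite !flatten_rcons.
have [le_s|/ltnW le_s] := leqP (size s') (size s) => eq_f.
  by have [/(IH _ ch_e ch_e')-> ->] :=
    edge_inj es es' (Dflat _ ch_e') le_s eq_f.
have [/esym/(IH _ ch_e ch_e')-> ->] //:=
  edge_inj es' es (Dflat _ ch_e) le_s (esym eq_f).
Qed.

Lemma chain_exists K :
    (forall w, D w -> exists v s,
      [/\ w = v ++ s, U s, size s <= K & v <> [::] -> D v]) ->
  forall w, D w -> exists e,
    [/\ chain [::] e, flatten e = w & forall s, s \in e -> size s <= K /\ U s].
Proof.
move=> split_w w; have [n] := ubnP (size w); elim: n w => // n IH w le_w Dw.
(* The least length of an admissible suffix leaves the longest prefix, hence gives an edge. *)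
pose good k := `[< exists v s,
  [/\ w = v ++ s, U s, size s = k & v <> [::] -> D v] >].
have ex_good : exists k, good k.
  have [v [s [? ? _ ?]]] := split_w w Dw.
  by exists (size s); apply/asboolP; exists v, s.
have [k /asboolP[v [s [def_w Us sz_s Dv]]] k_min] := ex_minnP ex_good.
have le_k : k <= K.
  have [v1 [s1 [? ? le1 ?]]] := split_w w Dw.
  by apply: leq_trans (k_min (size s1) _) le1; apply/asboolP; exists v1, s1.
have [e [ch_e fl_e e_small]] : exists e, [/\ chain [::] e, flatten e = v &
    forall s, s \in e -> size s <= K /\ U s].
  have [->|/eqP v_neq0] := eqVneq v [::]; first by exists [::].
  apply: IH (Dv v_neq0); move: le_w; rewrite def_w size_cat.
  by case: (s) Us => //= a s' _; lia.
exists (rcons e s); split.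
- apply/chain_rcons; rewrite fl_e /=; split=> //.
  split=> //; first by rewrite -def_w.
  move=> s1 s2 def_s s1_neq0 Dvs1 Us2.
  have /k_min : good (size s2).
    by apply/asboolP; exists (v ++ s1), s2; rewrite -catA -def_s.
  by rewrite -sz_s def_s size_cat; case: (s1) s1_neq0 => //= *; lia.
- by rewrite flatten_rcons fl_e.
- by move=> s1; rewrite mem_rcons inE => /predU1P[->|/e_small //]; rewrite sz_s.
Qed.

(** An edge out of [v] tests [D] only on extensions of [v], so only the residual of [D] at [v]
    matters. *)
Lemma chain_state (Q : Type) (step : Q -> A -> Q) (q0 : Q) (F : pred Q) :
    (forall w, D w <-> F (foldl step q0 w)) ->
  forall e v v', foldl step q0 v = foldl step q0 v' ->
  chain v e <-> chain v' e.
Proof.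
move=> DF.
have Dcat v v' w :
    foldl step q0 v = foldl step q0 v' -> D (v ++ w) <-> D (v' ++ w).
  by rewrite !DF !foldl_cat => ->.
suff imp e v v' : foldl step q0 v = foldl step q0 v' -> chain v e -> chain v' e.
  by move=> e v v' eq_v; split; apply: imp.
elim: e v v' => //= s e IH v v' eq_v [[Us Dvs vs_min] ch]; split.
  split=> //; first by apply/(Dcat _ _ _ eq_v).
  by move=> s1 s2 def_s s1_neq0 /(Dcat _ _ _ eq_v); apply: vs_min.
by apply: IH ch; rewrite !foldl_cat eq_v.
Qed.

End Factorisation.

Section FiniteReesIndex.
Variables (S : semigroupType) (P : {pred S}).
Hypothesis finP : finite_set [set x : S | x \notin P].

Section Restriction.
Variables (A : finType) (phi : A -> S) (L : set (seq A)).
Hypothesis LM : Markov_language phi L.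

Let inP : set (seq A) := [set w | represents_in phi P w].
Let LP := L `&` inP.

Lemma exists_bounded_word :
  exists N, forall s, s \notin P ->
    exists w, [/\ size w <= N, L w & represents phi w s].
Proof.
have /finite_seqP[r def_r] := finP.
have /choice[W WP] (s : S) : exists w, L w /\ represents phi w s.
  by case: LM => _ _ _ /(_ s)[w [? _]]; exists w.
exists (\max_(s <- r) size (W s)) => s sP; exists (W s).
case: (WP s) => ? ?; split => //.
have : [set x : S | x \notin P] s by [].
by rewrite def_r /= => sr; apply: leq_bigmax_seq.
Qed.

(** By uniqueness, a word of [L] with value outside [P] is the bounded word of that value. *)
Lemma long_words_in : exists N, forall w, L w -> N < size w -> inP w.
Proof.
have [N Nw] := exists_bounded_word; exists N => w Lw lt_w.
have [|s ws] := @represents_total _ _ phi w.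
  by move=> w0; rewrite w0 in lt_w.
have [sP|/Nw[v [le_v Lv vs]]] := boolP (s \in P); first by exists s.
by move: le_v; rewrite (Markov_language_inj LM Lv Lw vs ws) leqNgt lt_w.
Qed.

Lemma regular_restriction : regular LP.
Proof.
have [N longP] := long_words_in; case: LM => _ [M ML] _ _.
pose st := foldl (@dfa_step A M) (dfa_init M).
(* [L] and [LP] differ only in words of length at most [N]. Up to that length the word itself is
   kept; [None] marks a longer one, whose extensions in [L] all lie in [LP]. *)
pose c w : dfa_state M * option (N.-bseq A) := (st w, insub w).
apply: (@regular_of_residuals _ _ c) => u v [eq_st].
case: insubP => [x _ <- | lt_u]; case: insubP => [y _ <- | lt_v] //.
  by case=> ->.
move=> _ z.
have longL w : N < size w -> LP (w ++ z) <-> L (w ++ z).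
  move=> lt_w; split=> [[]//|Lwz]; split=> //; apply: longP => //.
  by rewrite size_cat ltn_addr.
by rewrite !longL ?ltnNge // !ML /dfa_accepts !foldl_cat -!/(st _) eq_st.
Qed.

(** * Bounded labels and the Markov language for T *)

Lemma exists_short_suffix : exists K, forall w, LP w -> exists v s,
  [/\ w = v ++ s, inP s, size s <= K & v <> [::] -> LP v].
Proof.
have [N shortN] := exists_bounded_word; have [N' longP] := long_words_in.
case: (LM) => _ [M ML] prefL _.
pose st := foldl (@dfa_step A M) (dfa_init M).
(* One more than the number of pairs of a state and a word of length at most [N], for the pigeonhole
   principle. Adding [N'] to the bound makes every prefix [p i] long enough for its value to lie in
   [P]. *)
pose n := #|{: dfa_state M * N.-bseq A}|.+1.
exists (N' + n) => w [Lw wP].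
have [le_w|lt_w] := leqP (size w) (N' + n); first by exists [::], w.
pose p (i : 'I_n) := take (size w - i.+1) w.
pose q (i : 'I_n) := drop (size w - i.+1) w.
have size_q i : size (q i) = i.+1.
  by rewrite size_drop; have := ltn_ord i; lia.
have size_p i : N' < size (p i).
  by rewrite size_takel; have := ltn_ord i; lia.
have def_w i : w = p i ++ q i by rewrite cat_take_drop.
have q_neq0 i : q i <> [::] by move/(congr1 size); rewrite size_q.
have p_neq0 i : p i <> [::] by move=> p0; have := size_p i; rewrite p0.
have Lp i : L (p i) by apply: (prefL _ (q i)) => //; rewrite -def_w.
have [[i qi]|no_suffix] := pselect (exists i, inP (q i)).
  exists (p i), (q i); split=> //.
    by rewrite size_q; have := ltn_ord i; lia.
  by move=> _; split=> //; apply: longP.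
(* All [q i] now have values outside [P]; a bounded word [x i] encodes each value in a finite
   type. *)
have /choice[x xP] (i : 'I_n) : exists x : N.-bseq A, exists s,
    represents phi x s /\ represents phi (q i) s.
  have [s qs] := represents_total phi (@q_neq0 i).
  have [|/shortN[u [le_u _ us]]] := boolP (s \in P).
    by move=> sP; case: no_suffix; exists i, s.
  by exists (Bseq le_u), s.
have /injectivePn[i [j neq_ij [eq_st eq_x]]] :
    ~~ injectiveb (fun i => (st (p i), x i)).
  by apply/injectiveP => /leq_card; rewrite card_ord ltnn.
(* [p i] and [p j] reach the same state, so they may be exchanged before [q j]. The new word has the
   value of [w] but, as [i] and [j] differ, another length, against uniqueness. *)
have Lpq : L (p i ++ q j).
  by move: Lw; rewrite (def_w j) !ML /dfa_accepts !foldl_cat -!/(st _) eq_st.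
have [a pa] := represents_total phi (@p_neq0 i).
have [si [xi qi]] := xP i; have [sj [xj qj]] := xP j.
rewrite -eq_x in xj; have eq_s := represents_functional xi xj.
have pqi := represents_cat pa qi; rewrite eq_s -def_w in pqi.
have := Markov_language_inj LM Lw Lpq pqi (represents_cat pa qj).
rewrite {1}(def_w i) => /(congr1 size); rewrite !size_cat !size_q => /eqP.
by rewrite eqn_add2l eqSS => /eqP/val_inj/eqP; rewrite (negPf neq_ij).
Qed.

Lemma Markov_restriction (T : subSemigroupType P) : Markov T.
Proof.
have [K shortK] := exists_short_suffix.
have inP0 : ~ inP [::] by move/represents_in_neq0.
pose B := {b : K.-bseq A | `[< inP b >]}.
pose f (b : B) : seq A := val b.
have f_inj : injective f by move=> b b' /val_inj/val_inj.
have /choice[psi fpsi] (b : B) : exists t : T, represents phi (f b) (val t).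
  have /asboolP[s sP bs] := valP b.
  by exists (Sub s sP); rewrite SubK.
pose ch e := chain LP inP [::] (map f e).
pose L' : set (seq B) := [set e | e <> [::] /\ ch e].
have flatP e t : represents psi e t ->
    represents phi (flatten (map f e)) (val t).
  by apply: represents_flatten => //; apply: valM.
have map_neq0 e : e <> [::] -> map f e <> [::] by case: e.
have L'M : Markov_language psi L'; last first.
  by exists B, psi; split; [apply: Markov_language_generates L'M | exists L'].
split=> [[]//||u v u_neq0 _ [_]|t].
- have [M ML] := regular_restriction.
  pose st := foldl (@dfa_step A M) (dfa_init M).
  (* [ch [::]] holds while [L'] leaves out the empty word, so emptiness is recorded besides being a
     path and the state reached. *)
  pose c e := (nilp e, `[< ch e >], st (flatten (map f e))).
  apply: (@regular_of_residuals _ _ c) => u v [eq_nil eq_ch eq_st] z.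
  have eq_z : ch (u ++ z) <-> ch (v ++ z).
    rewrite /ch !map_cat !chain_cat /= (chain_state _ ML _ eq_st).
    by rewrite -/(ch u) (asbool_eq_equiv eq_ch).
  suff eq_neq0 : (u ++ z <> [::]) <-> (v ++ z <> [::]).
    by rewrite /L' /= eq_neq0 eq_z.
  by case: u v eq_nil {eq_ch eq_st eq_z} => [|? ?] [].
- by rewrite /ch map_cat chain_cat => -[ch_u _]; split.
have [_ _ _ /(_ (val t))[w [[Lw wt] _]]] := LM.
have LPw : LP w by split=> //; exists (val t) => //; apply: valP.
have [e' [ch_e' fl_e' e'_small]] := chain_exists inP0 shortK LPw.
have [e def_e'] : exists e, e' = map f e.
  elim: e' e'_small {ch_e' fl_e'} => [|s e' IH] e'_small; first by exists [::].
  have [|e ->] := IH.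
    by move=> s1 s1e; apply: e'_small; rewrite inE s1e orbT.
  have [le_s /asboolP sP] := e'_small s (mem_head _ _).
  by exists ((exist _ (Bseq le_s) sP : B) :: e).
rewrite {}def_e' in ch_e' fl_e' e'_small.
have w_neq0 : w <> [::] by move=> w0; rewrite w0 in wt.
have e_neq0 : e <> [::] by move=> e0; rewrite -fl_e' e0 in w_neq0.
exists e; split; first split=> //.
  have [t' et'] := represents_total psi e_neq0.
  have := flatP _ _ et'; rewrite fl_e' => /(represents_functional wt)/val_inj.
  by move->.
(* Another path with value [t] spells a word of [L] for [val t], which must be [w]. *)
move=> e1 [[e1_neq0 ch_e1] /flatP e1t]; apply: (inj_map f_inj).
apply: (chain_inj inP0 ch_e' ch_e1); rewrite fl_e'.
have [Le1 _] := chain_flatten ch_e1 (map_neq0 _ e1_neq0).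
exact: Markov_language_inj LM Lw Le1 wt e1t.
Qed.

End Restriction.

(** * Extending a Markov language from T to S *)

Lemma Markov_extension (T : subSemigroupType P) : Markov T -> Markov S.
Proof.
case=> A [phi [_ [L LM]]].
have /finite_seqP[r def_r] := finP.
have rP s : (s \notin P) = (s \in r).
  have : [set x : S | x \notin P] s <-> [set` r] s by rewrite def_r.
  by move=> /= [nP_r r_nP]; apply/idP/idP.
pose B : finType := (A + seq_sub r)%type.
pose psi (b : B) : S :=
  match b with inl a => val (phi a) | inr x => ssval x end.
pose L' : set (seq B) := [set e |
  (exists2 w, e = map inl w & L w) \/ exists x, e = [:: inr x]].
have inlP w t : represents phi w t -> represents psi (map inl w) (val t).
  rewrite -flatten_map1; apply: represents_flatten => //.
  exact: valM.
case: (LM) => L0 [M ML] prefL LT.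
have L'M : Markov_language psi L'; last first.
  by exists B, psi; split; [apply: Markov_language_generates L'M | exists L'].
split.
- by case=> [[w /esym/(congr1 size)/=]|[]//]; rewrite size_map => /size0nil ->.
- pose Q : finType := option (option (bool * dfa_state M)).
  (* [Some (Some (b, q))]: only letters of A were read, b says whether any was;
     [Some None]: a single new letter was read; [None]: sink. *)
  pose step (q : Q) (b : B) : Q := match q, b with
    | Some (Some (_, q)), inl a => Some (Some (true, dfa_step q a))
    | Some (Some (false, _)), inr _ => Some None
    | _, _ => None end.
  pose final (q : Q) := match q with
    | Some (Some (_, q)) => q \in @dfa_final A M
    | Some None => true
    | None => false end.
  exists (@Dfa B Q (Some (Some (false, dfa_init M))) step final) => e.
  rewrite /dfa_accepts /= unfold_in.
  have sinkE e1 : foldl step None e1 = None by elim: e1.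
  have newE e1 : final (foldl step (Some None) e1) <-> e1 = [::].
    by case: e1 => [|b e1] //=; rewrite sinkE.
  have oldE q e1 : final (foldl step (Some (Some (true, q))) e1) <->
      exists2 w, e1 = map inl w & foldl (@dfa_step A M) q w \in @dfa_final A M.
    elim: e1 q => [|[a|x] e1 IH] q /=.
    + by split=> [?|[[|//]]] //; exists [::].
    + rewrite IH; split=> [[w -> wF]|[[|a' w] //= [-> ->] wF]].
        by exists (a :: w).
      by exists w.
    + by rewrite sinkE; split=> // -[[]].
  case: e => [|[a|x] e] /=.
  + split=> [[[[|//] _ /ML //]|[]//]|F0].
    by left; exists [::] => //; apply/ML.
  + rewrite oldE; split=> [[[[|a' w] //= [-> ->] /ML wF]|[]//]|[w -> wF]].
      by exists w.
    by left; exists (a :: w) => //; apply/ML.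
  + by rewrite newE; split=> [[[[]//]|[y [_ ->]]]|->] //; right; exists x.
- move=> u v u_neq0 v_neq0 [[w def_w Lw]|[x]]; last first.
    by case: u v u_neq0 v_neq0 => [|b [|b' u]] // [].
  left; exists (take (size u) w).
    by rewrite map_take -def_w take_size_cat.
  have def_v : v = map inl (drop (size u) w).
    by rewrite map_drop -def_w drop_size_cat.
  apply: (prefL _ (drop (size u) w)); last by rewrite cat_take_drop.
  - move=> w0; apply: u_neq0.
    by rewrite -(take_size_cat v (erefl (size u))) def_w -map_take w0.
  - by move=> w0; apply: v_neq0; rewrite def_v w0.
(* Old words have values in [P] and new letters values outside it, so the two kinds never represent
   the same element. *)
- move=> s; have [sP|] := boolP (s \in P).
    have [w [[Lw wt] w_uniq]] := LT (Sub s sP).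
    have ws := inlP _ _ wt; rewrite SubK in ws.
    exists (map inl w); split=> [|_ [[[w' -> Lw']|[x ->]]]].
    + by split=> //; left; exists w.
    + have [|t w't] := @represents_total _ _ phi w'.
        by move=> w'0; apply: L0; rewrite -w'0.
      move=> /(represents_functional (inlP _ _ w't)) val_t.
      congr map; apply: w_uniq; split=> //.
      suff <- : t = Sub s sP by [].
      by apply: val_inj; rewrite SubK.
    + by move=> /= xs; have := ssvalP x; rewrite -rP xs sP.
  move=> sP; have sr := sP; rewrite rP in sr.
  exists [:: inr (SeqSub sr)]; split=> [|_ [[[w -> Lw]|[x ->]]]].
  + by split=> //; right; exists (SeqSub sr).
  + have [|t wt] := @represents_total _ _ phi w.
      by move=> w0; apply: L0; rewrite -w0.
    move=> /(represents_functional (inlP _ _ wt)) val_t.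
    by case/negP: sP; rewrite -val_t; apply: valP.
  + by move=> /= xs; congr [:: inr _]; apply: val_inj.
Qed.

End FiniteReesIndex.

Theorem theorem16p1 (S : semigroupType) (P : {pred S})
    (T : subSemigroupType P) :
  finite_set [set x : S | x \notin P] ->
  (Markov T -> Markov S) /\ (Markov S -> Markov T).
Proof.
move=> finP; split; first exact: Markov_extension.
by case=> A [phi [_ [L LM]]]; apply: (Markov_restriction finP LM).
Qed.
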